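(* Let $L \subset \mathbb{R}^n$ be a strongly perfect lattice. Then $L$ is extreme, i.e. $L$ is a local maximum of the density function $\delta$ on the space of similarity classes of $n$-dimensional lattices.
   Context: A lattice $L$ of dimension $n$ is the set of all integral linear combinations of the vectors of a basis $(b_1,\dots,b_n)$ of the Euclidean space $(\mathbb{R}^n,(\cdot,\cdot))$. Its minimum is $\min(L) = \min\{(x,x) \mid 0 \neq x \in L\}$, its set of minimal vectors is $\mathrm{Min}(L) = \{x \in L \mid (x,x) = \min(L)\}$, and its determinant is $\det(L) = \det((b_i,b_j))_{i,j=1}^n$. The density of $L$ is $$\delta(L) = \frac{V_n}{2^n}\sqrt{\frac{\min(L)^n}{\det(L)}},$$ where $V_n$ is the volume of the $n$-dimensional unit ball; $\delta$ is invariant under similarities and so is a function on the space of similarity classes of $n$-dimensional lattices. A lattice is called extreme if it is a local maximum of $\delta$ on this space. A nonempty finite subset $X$ of the sphere $S^{n-1} = \{x \in \mathbb{R}^n \mid (x,x) = 1\}$ is called a spherical $t$-design if $$\frac{1}{|X|}\sum_{x \in X} f(x) = \int_{S^{n-1}} f(x)\, d\mu(x)$$ for all homogeneous polynomials $f \in \mathbb{R}[x_1,\dots,x_n]$ of degree $k \le t$, where $\mu$ is the $O_n(\mathbb{R})$-invariant measure on $S^{n-1}$ of total mass $1$. A lattice $L$ is called strongly perfect if $\mathrm{Min}(L)$, rescaled by the factor $1/\sqrt{\min(L)}$ so as to lie on $S^{n-1}$, is a spherical $4$-design. *)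

(* Defs.v *)
From HB Require Import structures.
From mathcomp Require Import all_boot all_order all_algebra finmap.
From mathcomp.multinomials Require mpoly.
From mathcomp Require Import all_classical all_reals all_analysis.

Set Implicit Arguments.
Unset Strict Implicit.
Unset Printing Implicit Defensive.

Import Order.TTheory GRing.Theory Num.Theory.
Import numFieldNormedType.Exports.

Local Open Scope classical_set_scope.
Local Open Scope ring_scope.

Section EuclideanSpace.
Context {R : realType} {n : nat}.
Implicit Types (u v : 'rV[R]_n) (P : 'M[R]_n).

Definition dot u v : R := \sum_(i < n) u 0 i * v 0 i.

Definition unit_sphere : set 'rV[R]_n := [set x | dot x x = 1].
Definition unit_ball : set 'rV[R]_n := [set x | dot x x <= 1].

Definition orthogonal_mx P : Prop := P *m P^T = 1%:M.

End EuclideanSpace.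

Arguments unit_sphere : clear implicits.
Arguments unit_ball : clear implicits.

(* n-dimensional Lebesgue measure by slicing (Cavalieri), i.e. the product
   measure lambda x ... x lambda; it is only used on the unit ball below. *)
Fixpoint volume {R : realType} (n : nat) : set 'rV[R]_n -> \bar R :=
  match n with
  | 0 => fun A => (\1_A 0)%:E
  | m.+1 => fun A =>
      (\int[lebesgue_measure]_t
         volume [set x : 'rV[R]_m | A (row_mx (t%:M : 'rV[R]_1) x)])%E
  end.

Definition unit_ball_volume (R : realType) (n : nat) : R :=
  fine (volume (unit_ball R n)).

Section Lattices.
Context {R : realType} {n : nat}.
Implicit Types (B : 'M[R]_n) (L : set 'rV[R]_n).

(* A basis of R^n is given by the rows of an invertible matrix. *)
Definition lattice_of B : set 'rV[R]_n :=
  [set x | exists a : 'I_n -> int, x = \sum_(i < n) (a i)%:~R *: row i B].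

Definition is_lattice L : Prop :=
  exists2 B : 'M[R]_n, B \in unitmx & L = lattice_of B.

(* [xget d S] is an element of S, or d if S is empty; here S has at most one
   element, and exactly one if L is a lattice and 0 < n. *)
Definition lattice_min L : R :=
  let norms := [set dot x x | x in [set x | L x /\ x <> 0]] in
  xget 0 [set m | norms m /\ lbound norms m].

Definition min_vectors L : set 'rV[R]_n :=
  [set x | L x /\ dot x x = lattice_min L].

Definition gram B : 'M[R]_n := \matrix_(i, j) dot (row i B) (row j B).

(* The value does not depend on the basis B of L that [xget] picks. *)
Definition lattice_det L : R :=
  \det (gram (xget 1%:M [set B | B \in unitmx /\ L = lattice_of B])).

Definition density L : R :=
  unit_ball_volume R n / 2 ^+ n
    * Num.sqrt (lattice_min L ^+ n / lattice_det L).

End Lattices.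

Section SimilarityClasses.
Context (R : realType) (n : nat).

Definition similar (L L' : set 'rV[R]_n) : Prop :=
  exists (c : R) (P : 'M[R]_n),
    [/\ 0 < c, orthogonal_mx P & L' = [set c *: (x *m P) | x in L]].

(* GL_n(R), with the topology induced from the matrices *)
Definition bases := [set B : 'M[R]_n | B \in unitmx].

Definition similar_bases : rel bases := fun B B' =>
  `[< similar (lattice_of (set_val B)) (lattice_of (set_val B')) >].

Lemma similar_bases_refl : reflexive similar_bases.
Proof.
move=> B; apply/asboolP; exists 1, 1%:M; split => //.
  by rewrite /orthogonal_mx trmx1 mulmx1.
by apply/seteqP; split => [x Lx|x [y Ly <-]]; first exists x => //;
  rewrite scale1r mulmx1.
Qed.

Lemma similar_bases_sym : symmetric similar_bases.
Proof.
suff H B B' : similar_bases B B' -> similar_bases B' B.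
  by move=> B B'; apply/idP/idP; exact: H.
move=> /asboolP[c [P [c0 PP E]]]; apply/asboolP; exists c^-1, P^T; split.
- by rewrite invr_gt0.
- by rewrite /orthogonal_mx trmxK; exact: mulmx1C.
- rewrite E; apply/seteqP; split => [x Lx|x [_ [y Ly <-] <-]].
    exists (c *: (x *m P)); first by exists x.
    by rewrite -scalemxAl scalerA mulVf ?gt_eqF// scale1r -mulmxA PP mulmx1.
  by rewrite -scalemxAl scalerA mulVf ?gt_eqF// scale1r -mulmxA PP mulmx1.
Qed.

Lemma similar_bases_trans : transitive similar_bases.
Proof.
move=> B2 B1 B3 /asboolP[c [P [c0 PP E]]] /asboolP[d [Q [d0 QQ F]]].
apply/asboolP; exists (d * c), (P *m Q); split.
- exact: mulr_gt0.
- by rewrite /orthogonal_mx trmx_mul mulmxA -(mulmxA P) QQ mulmx1.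
- rewrite F E; apply/seteqP; split => [_ [_ [x Lx <-] <-]|_ [x Lx <-]].
    by exists x => //; rewrite -scalemxAl scalerA mulmxA.
  exists (c *: (x *m P)); first by exists x.
  by rewrite -scalemxAl scalerA mulmxA.
Qed.

Canonical similar_bases_equiv :=
  EquivRel similar_bases similar_bases_refl similar_bases_sym
    similar_bases_trans.

(* Every lattice is [lattice_of] some basis, so the quotient of GL_n(R) by
   "generating similar lattices" is the set of similarity classes of lattices;
   its topology is the quotient topology, that of
   R_{>0} O_n(R) \ GL_n(R) / GL_n(Z). *)
Definition similarity_class : topologicalType :=
  quotient_topology {eq_quot similar_bases}%qT.

Definition class_of (B : bases) : similarity_class :=
  (\pi_similarity_class B)%qT.

(* The density is invariant under similarities, so that the choice of a
   representative is irrelevant. *)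
Definition class_density (s : similarity_class) : R :=
  density (lattice_of (set_val (repr s : bases))).

Definition local_maximum (T : topologicalType) (f : T -> R) (s : T) : Prop :=
  \forall t \near s, f t <= f s.

Definition extreme (L : set 'rV[R]_n) : Prop :=
  exists2 B : bases, L = lattice_of (set_val B) &
    local_maximum class_density (class_of B).

End SimilarityClasses.

Arguments bases : clear implicits.

Section SphericalDesigns.
(* The notations of mpoly clash with those of mathcomp-analysis. *)
Import -(notations) mpoly.
Context {R : realType} {n : nat}.

(* R^n with its Borel sigma-algebra *)
Definition borel_space := g_sigma_algebraType (@open 'rV[R]_n).

(* The O_n(R)-invariant measure of total mass 1 on the sphere, seen as a
   measure on R^n concentrated on the sphere. *)
Definition sphere_measure (mu : probability borel_space R) : Prop :=
  mu (unit_sphere R n) = 1%E /\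
  forall P : 'M[R]_n, orthogonal_mx P ->
    forall A : set borel_space, measurable A ->
      mu ((fun x : 'rV[R]_n => x *m P) @^-1` A) = mu A.

Definition spherical_design (t : nat) (X : set 'rV[R]_n) : Prop :=
  [/\ finite_set X, X !=set0, X `<=` unit_sphere R n &
    exists2 mu : probability borel_space R, sphere_measure mu &
      forall (k : nat) (f : mpoly n R), (k <= t)%N ->
        f \is ishomog1 k mdeg ->
        (#|` fset_set X|%:R)^-1
            * \sum_(x \in X) meval (fun i => x 0 i) f =
          \int[mu]_(x in unit_sphere R n)
            meval (fun i => (x : 'rV[R]_n) 0 i) f].

Definition strongly_perfect (L : set 'rV[R]_n) : Prop :=
  spherical_design 4
    [set (Num.sqrt (lattice_min L))^-1 *: x | x in min_vectors L].

End SphericalDesigns.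

(* Main.v *)
Require Import Defs.
From mathcomp Require Import all_boot all_order all_algebra all_fingroup finmap.
From mathcomp Require Import all_classical all_reals all_analysis.
From mathcomp Require Import measurable_realfun ring lra.
From mathcomp.multinomials Require mpoly.

(** Write a lattice near [L] as [L T] and put [S = T T^T]. Its minimum is at
    most the values of [x S x^T] at the minimal vectors [x] of [L], so with [r]
    the least of these values, relative to [min L], it suffices to prove
    [r ^ n <= det S]. Now [S = r (1 + F)] with [F] small and [x F x^T >= 0] at
    the minimal vectors.

    Averages of quartic monomials over a spherical 4-design inherit the
    orthogonal invariance of the sphere measure, hence
    [E[x_i x_j x_k x_l] = b (d_ij d_kl + d_ik d_jl + d_il d_jk)] with [b > 0].
    So [E[x F x^T * x_i x_j] = b (2 F_ij + d_ij tr F)]; since [x F x^T >= 0] and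
    [|x_i x_j| <= 1], the left-hand side is at most [E[x F x^T]], a multiple of
    [tr F]. All the entries of [F] are thus [O(tr F)], and
    [det (1 + F) = 1 + tr F + O((tr F) ^ 2) >= 1]. This replaces both halves of
    Voronoi's criterion, perfection and eutaxy, by a single estimate. *)

Set Implicit Arguments.
Unset Strict Implicit.
Unset Printing Implicit Defensive.

Import Order.TTheory GRing.Theory Num.Theory.
Import numFieldNormedType.Exports.

Local Open Scope classical_set_scope.
Local Open Scope ring_scope.

(** * Determinants near the identity *)

(** The constant is uniform in [f]: each new factor at most doubles the previous error and adds
    [f i * s], of absolute value at most [(size r)%:R * e ^+ 2]. *)
Lemma prod1D_approx (R : realFieldType) (I : Type) (r : seq I) :
  exists2 C : R, 0 <= C & forall (f : I -> R) (e : R), e <= 1 ->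
    (forall i, `|f i| <= e) ->
    `|\prod_(i <- r) (1 + f i) - (1 + \sum_(i <- r) f i)| <= C * e ^+ 2.
Proof.
elim: r => [|i r [C C0 IH]].
  by exists 0 => // f e _ _; rewrite !big_nil addr0 subrr normr0 mul0r.
exists (2 * C + (size r)%:R) => [|f e e1 fe].
  by rewrite addr_ge0 ?mulr_ge0.
rewrite !big_cons.
set p := \prod_(j <- r) _; set s := \sum_(j <- r) _.
have -> : (1 + f i) * p - (1 + (f i + s)) =
          (1 + f i) * (p - (1 + s)) + f i * s by ring.
have sle : `|s| <= (size r)%:R * e.
  apply: le_trans (ler_norm_sum _ _ _) _.
  rewrite mulr_natl -sum1_size -sumrMnr; exact: ler_sum.
have e0 : 0 <= e by apply: le_trans (fe i).
rewrite [leRHS]mulrDl; apply: le_trans (ler_normD _ _) _.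
apply: lerD; rewrite normrM.
  rewrite -mulrA; apply: ler_pM => //; last exact: IH.
  by apply: le_trans (ler_normD _ _) _; rewrite normr1 lerD2l (le_trans (fe i)).
by rewrite expr2 mulrCA; apply: ler_pM => //; rewrite mulrC.
Qed.

(** In the Leibniz expansion the identity permutation gives [1 + \tr F] up to second order. Any
    other permutation moves some [i] and also [s i], so its product contains two off-diagonal
    entries and is of order [e ^+ 2]. *)
Lemma det1D_ge (R : realFieldType) (n : nat) :
  exists2 C : R, 0 <= C & forall (F : 'M[R]_n) (e : R), e <= 1 ->
    (forall i j, `|F i j| <= e) ->
    1 + \tr F - C * e ^+ 2 <= \det (1%:M + F).
Proof.
have [C C0 diag_approx] := @prod1D_approx R _ (index_enum 'I_n).
exists (C + \sum_(s : 'S_n | s != 1%g) 2 ^+ n) => [|F e e1 Fe].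
  by rewrite addr_ge0 ?sumr_ge0// => s _; rewrite exprn_ge0.
have entry i j : `|(1%:M + F) i j| <= 2.
  rewrite !mxE; apply: le_trans (ler_normD _ _) _.
  rewrite [leRHS](_ : 2 = 1 + 1)//; apply: lerD; last exact: le_trans (Fe i j) e1.
  by case: (i == j); rewrite ?normr1 ?normr0.
have /ler_normlP[diag_le _] := diag_approx (fun i => F i i) e e1 (fun i => Fe i i).
have off_le (s : 'S_n) : s != 1%g ->
    `|(-1) ^+ s * \prod_i (1%:M + F) i (s i)| <= 2 ^+ n * e ^+ 2.
  move=> s1; rewrite normrM normr_sign mul1r normr_prod.
  have [i si] : exists i, s i != i.
    apply/existsP; apply: contra_neqT s1 => /existsPn s1.
    by apply/permP => i; rewrite perm1; apply/eqP; rewrite -[_ == _]negbK s1.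
  have ssi : s (s i) != s i by rewrite (inj_eq perm_inj).
  have e0 : 0 <= e by apply: le_trans (Fe i i).
  have off k : s k != k -> `|(1%:M + F) k (s k)| <= e.
    by move=> sk; rewrite !mxE eq_sym (negbTE sk) add0r.
  rewrite (bigD1 i)//= (bigD1 (s i))//= mulrA mulrC.
  apply: ler_pM; rewrite ?mulr_ge0 ?prodr_ge0//; last first.
    by rewrite expr2 ler_pM// off.
  apply: (@le_trans _ _ (\prod_(k | (k != i) && (k != s i)) 2)).
    by apply: ler_prod => k _; rewrite entry normr_ge0.
  (* At most [n] factors remain, each bounded by 2, so [2 ^+ n] is a crude bound. *)
  rewrite prodr_const ler_eXn2l ?ltr1n//.
  by rewrite -[X in (_ <= X)%N]card_ord max_card.
rewrite /determinant [leRHS](bigD1 1%g)//= odd_perm1 expr0 mul1r.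
have -> : \prod_i (1%:M + F) i ((1%g : 'S_n) i) = \prod_i (1 + F i i).
  by apply: eq_bigr => i _; rewrite perm1 !mxE eqxx.
have : `|\sum_(s : 'S_n | s != 1%g) (-1) ^+ s * \prod_i (1%:M + F) i (s i)|
    <= (\sum_(s : 'S_n | s != 1%g) 2 ^+ n) * e ^+ 2.
  apply: le_trans (ler_norm_sum _ _ _) _.
  rewrite mulr_suml; exact: ler_sum.
move=> /ler_normlP[off _]; move: off diag_le; rewrite /mxtrace.
move: (\sum_(s | _) _) (\sum_(s | _) _) (\prod_i _) (\sum_i _) => a c p t.
clear; lra.
Qed.

Lemma exists_min_seq (R : realDomainType) (T : eqType) (f : T -> R) (s : seq T) :
  s != [::] -> exists2 x, x \in s & forall y, y \in s -> f x <= f y.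
Proof.
elim: s => // a s IH _; have [->|/IH[x xs xmin]] := eqVneq s [::].
  by exists a; rewrite ?mem_head// => y /[!inE]/eqP->.
have [ax|xa] := leP (f a) (f x).
  exists a; rewrite ?mem_head// => y /[!inE]/orP[/eqP->//|/xmin].
  exact: le_trans.
exists x; rewrite ?inE ?xs ?orbT// => y /orP[/eqP->|/xmin//].
exact: ltW.
Qed.

(** * Quartic moments invariant under the orthogonal group *)

Section Moments.
Variables (R : realFieldType) (n : nat) (s : seq 'rV[R]_n).

Definition moment4 (i j k l : 'I_n) : R :=
  \sum_(x <- s) x 0 i * x 0 j * x 0 k * x 0 l.

Definition quad_form (F : 'M[R]_n) (x : 'rV[R]_n) : R := (x *m F *m x^T) 0 0.

Lemma quad_formE F x : quad_form F x = \sum_i \sum_j F i j * (x 0 i * x 0 j).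
Proof.
rewrite /quad_form mxE exchange_big; apply: eq_bigr => j _ /=.
by rewrite !mxE mulr_suml; apply: eq_bigr => i _; ring.
Qed.

Lemma quad_form1 x : quad_form 1%:M x = \sum_i x 0 i * x 0 i.
Proof. by rewrite /quad_form mulmx1 mxE; apply: eq_bigr => i _; rewrite mxE. Qed.

Lemma moment4CA i j k l : moment4 i j k l = moment4 j i k l.
Proof. by apply: eq_bigr => x _; ring. Qed.

Lemma moment4AC i j k l : moment4 i j k l = moment4 i k j l.
Proof. by apply: eq_bigr => x _; ring. Qed.

Lemma moment4ACr i j k l : moment4 i j k l = moment4 i j l k.
Proof. by apply: eq_bigr => x _; ring. Qed.

Definition householder (v : 'rV[R]_n) : 'M[R]_n :=
  1%:M - (2 / (v *m v^T) 0 0) *: (v^T *m v).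

Lemma mul_householder (x v : 'rV[R]_n) i :
  (x *m householder v) 0 i =
  x 0 i - 2 / (v *m v^T) 0 0 * (x *m v^T) 0 0 * v 0 i.
Proof.
rewrite /householder mulmxBr mulmx1 -scalemxAr mulmxA [x *m v^T]mx11_scalar.
by rewrite mul_scalar_mx !mxE mulr1n mulrA.
Qed.

Lemma householder_orthogonal (v : 'rV[R]_n) : (v *m v^T) 0 0 != 0 ->
  householder v *m (householder v)^T = 1%:M.
Proof.
rewrite /householder; set q : R := (v *m v^T) 0 0 => q0.
have vv : v^T *m v *m (v^T *m v) = q *: (v^T *m v).
  rewrite mulmxA -(mulmxA v^T) [v *m v^T]mx11_scalar -/q.
  by rewrite mul_mx_scalar -scalemxAl.
rewrite [X in _ *m X](_ : _ = 1%:M - (2 / q) *: (v^T *m v)); last first.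
  by rewrite linearB /= linearZ /= trmx1 trmx_mul trmxK.
rewrite mulmxBl !mulmxBr !mul1mx mulmx1 -scalemxAl -scalemxAr vv !scalerA.
rewrite -addrA -opprD -scalerBl -scalerDl -[RHS]subr0; congr (_ - _).
by rewrite (_ : _ + _ = 0) ?scale0r//; field.
Qed.

Hypothesis invariant : forall P : 'M[R]_n, P *m P^T = 1%:M ->
  forall i j k l,
    \sum_(x <- s) (x *m P) 0 i * (x *m P) 0 j * (x *m P) 0 k * (x *m P) 0 l =
    moment4 i j k l.

Lemma dot_delta (x : 'rV[R]_n) i : (x *m (delta_mx 0 i : 'rV[R]_n)^T) 0 0 = x 0 i.
Proof. by rewrite trmx_delta -colE mxE. Qed.

(** The reflection along the basis vector e_i negates x_i alone. As [i] occurs exactly once in the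
    monomial, the moment equals its own negative. *)
Lemma moment4_odd i j k l : i != j -> i != k -> i != l -> moment4 i j k l = 0.
Proof.
move=> ij ik il; pose v : 'rV[R]_n := delta_mx 0 i.
have vv : (v *m v^T) 0 0 = 1 by rewrite dot_delta mxE !eqxx.
have vi : v 0 i = 1 by rewrite mxE !eqxx.
have vN a : i != a -> v 0 a = 0 by rewrite mxE eq_sym => /negbTE ->; rewrite andbF.
have v0 : (v *m v^T) 0 0 != 0 by rewrite vv oner_eq0.
have := invariant (householder_orthogonal v0) i j k l.
under eq_bigr => x _.
  rewrite !mul_householder vv dot_delta vi !vN//.
  rewrite (_ : _ * _ = - (x 0 i * x 0 j * x 0 k * x 0 l)); last by field.
  over.
rewrite sumrN -/(moment4 _ _ _ _) => /esym/eqP.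
by rewrite -addr_eq0 -mulr2n mulrn_eq0 => /eqP.
Qed.

(* Reflecting in [e_i + 2 e_j] mixes [x_i] and [x_j] with the rational
   coefficients 3/5 and 4/5. *)
Lemma moment4_rotation i j : i != j ->
  625 * moment4 i i i i =
  81 * moment4 i i i i + 864 * moment4 i i j j + 256 * moment4 j j j j.
Proof.
move=> ij; pose v : 'rV[R]_n := delta_mx 0 i + 2 *: delta_mx 0 j.
have vE (x : 'rV[R]_n) : (x *m v^T) 0 0 = x 0 i + 2 * x 0 j.
  rewrite linearD/= linearZ/= mulmxDr -scalemxAr.
  rewrite [LHS]mxE [X in _ + X = _]mxE; by rewrite !dot_delta.
have vi : v 0 i = 1 by rewrite !mxE !eqxx (negbTE ij) /=; ring.
have vj : v 0 j = 2 by rewrite !mxE !eqxx [j == i]eq_sym (negbTE ij) /=; ring.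
have vv : (v *m v^T) 0 0 = 5 by rewrite vE vi vj; ring.
have v0 : (v *m v^T) 0 0 != 0 by rewrite vv pnatr_eq0.
rewrite -{1}(invariant (householder_orthogonal v0)).
have e1 : moment4 i i i j = 0.
  rewrite moment4ACr moment4AC moment4CA; apply: moment4_odd; by rewrite eq_sym.
have e2 : moment4 i j j j = 0 by exact: moment4_odd.
(* The reflected x_i is (3 x_i - 4 x_j) / 5, and this is its expanded fourth power. The last two
   terms are odd in each variable and vanish by [e1] and [e2]. *)
transitivity (625 * \sum_(x <- s)
    ((81 / 625) * (x 0 i * x 0 i * x 0 i * x 0 i) +
     (864 / 625) * (x 0 i * x 0 i * x 0 j * x 0 j) +
     (256 / 625) * (x 0 j * x 0 j * x 0 j * x 0 j) -
     (432 / 625) * (x 0 i * x 0 i * x 0 i * x 0 j) -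
     (768 / 625) * (x 0 i * x 0 j * x 0 j * x 0 j))).
  congr (_ * _); apply: eq_bigr => x _.
  by rewrite !mul_householder vv vE vi; field.
rewrite !big_split/= !sumrN -!mulr_sumr.
rewrite -!/(moment4 _ _ _ _) e1 e2; by field.
Qed.

(** Only monomials whose indices pair up survive; the rotation identity makes the moments of x_i^4
    all equal and three times those of x_i^2 x_j^2, as for a Gaussian vector. *)
Lemma moment4E : exists b : R, forall i j k l,
  moment4 i j k l = b * ((i == j)%:R * (k == l)%:R + (i == k)%:R * (j == l)%:R
     + (i == l)%:R * (j == k)%:R).
Proof.
(* Write M_i and M_ij for the two moments. The rotation identities for (i, j) and (j, i) subtract to
   800 M_i = 800 M_j; substituting back gives 288 M_i = 864 M_ij. *)
have pair i j : i != j -> moment4 i i i i = moment4 j j j j /\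
    moment4 i i j j = moment4 i i i i / 3.
  move=> ij; have := moment4_rotation ij.
  have := @moment4_rotation j i; rewrite eq_sym ij => /(_ isT).
  have -> : moment4 j j i i = moment4 i i j j.
    by apply: eq_bigr => x _; ring.
  by lra.
have [b bE] : exists b, forall i j,
    moment4 i i j j = b * (1 + 2 * (i == j)%:R).
  case: (pickP 'I_n) => [i0 _|no]; last by exists 0 => i; have := no i.
  exists (moment4 i0 i0 i0 i0 / 3) => i j.
  have d a : moment4 a a a a = moment4 i0 i0 i0 i0.
    by have [->//|ai] := eqVneq a i0; have [] := pair _ _ ai.
  have [<-|ij] := eqVneq i j; first by rewrite d ?eqxx /=; field.
  by have [_ ->] := pair _ _ ij; rewrite d mulr0 addr0 mulr1.
(* Either the four indices pair up and [bE] applies, or some index occurs exactly once and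
   [moment4_odd] applies. *)
exists b => i j k l.
have [<-|ij] := eqVneq i j.
  have [<-|kl] := eqVneq k l.
    by rewrite bE; case: (i == k); rewrite /=; ring.
  rewrite (_ : moment4 _ _ _ _ = 0).
    have [ik|_] := eqVneq i k; have [il|_] := eqVneq i l; rewrite /=; try ring.
    by rewrite -ik il eqxx in kl.
  have [ik|ik] := eqVneq i k.
    rewrite (_ : moment4 _ _ _ _ = moment4 l i i k); last first.
      by apply: eq_bigr => x _; ring.
    by apply: moment4_odd; rewrite ?ik eq_sym.
  rewrite (_ : moment4 _ _ _ _ = moment4 k i i l); last first.
    by apply: eq_bigr => x _; ring.
  by apply: moment4_odd; rewrite // eq_sym.
have [<-|ik] := eqVneq i k.
  rewrite (eq_sym j i) (negbTE ij).
  have [<-|jl] := eqVneq j l.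
    by rewrite moment4AC bE (negbTE ij) /=; ring.
  rewrite moment4CA moment4_odd // 1?eq_sym//=; ring.
have [<-|il] := eqVneq i l.
  have [<-|jk] := eqVneq j k.
    by rewrite moment4ACr moment4AC bE (negbTE ij) /=; ring.
  rewrite moment4CA moment4_odd // 1?eq_sym//=; ring.
by rewrite moment4_odd //=; ring.
Qed.

(** * Quadratic forms on sets of unit vectors *)

Lemma sum_mul_delta (I : finType) (f : I -> R) k :
  \sum_i f i * (i == k)%:R = f k.
Proof.
rewrite (bigD1 k)//= eqxx mulr1 big1 ?addr0// => i /negbTE ->.
by rewrite mulr0.
Qed.

Hypothesis unit_norm : forall x, x \in s -> \sum_i x 0 i * x 0 i = 1.

Lemma unit_norm_le1 x k : x \in s -> `|x 0 k| <= 1.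
Proof.
move=> xs; have := unit_norm xs; rewrite (bigD1 k)//=.
have : 0 <= \sum_(i < n | i != k) x 0 i * x 0 i.
  by apply: sumr_ge0 => m _; rewrite -expr2 sqr_ge0.
move: (\sum_(i < n | i != k) _) (x 0 k) => t y t0 yt.
by rewrite ler_norml; apply/andP; split; nra.
Qed.

Lemma quad_form_moment (b : R) (F : 'M[R]_n) k l :
  (forall i j k l,
    moment4 i j k l = b * ((i == j)%:R * (k == l)%:R + (i == k)%:R * (j == l)%:R
     + (i == l)%:R * (j == k)%:R)) ->
  \sum_(x <- s) quad_form F x * (x 0 k * x 0 l) =
  b * (\tr F * (k == l)%:R + F k l + F l k).
Proof.
move=> bE.
transitivity (\sum_i \sum_j F i j * moment4 i j k l).
  under eq_bigr do rewrite quad_formE mulr_suml.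
  rewrite exchange_big; apply: eq_bigr => i _ /=.
  under eq_bigr do rewrite mulr_suml.
  rewrite exchange_big; apply: eq_bigr => j _ /=.
  by rewrite mulr_sumr; apply: eq_bigr => x _; ring.
(* One summand for each of the three pairings in the moment formula. *)
transitivity (b * (\sum_i \sum_j F i j * (j == i)%:R * (k == l)%:R
   + \sum_i (\sum_j F i j * (j == l)%:R) * (i == k)%:R
   + \sum_i (\sum_j F i j * (j == k)%:R) * (i == l)%:R)).
  rewrite -!big_split mulr_sumr; apply: eq_bigr => i _ /=.
  rewrite !mulr_suml -!big_split mulr_sumr; apply: eq_bigr => j _ /=.
  by rewrite bE (eq_sym j i); ring.
rewrite !sum_mul_delta; congr (_ * (_ + _ + _)).
under eq_bigr do rewrite -mulr_suml sum_mul_delta.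
by rewrite -mulr_suml.
Qed.

(** Inserting the factor \sum_k x_k^2 = 1 turns a sum of quadratic values into quartic moments. *)
Lemma sum_quad_form (F : 'M[R]_n) :
  \sum_(x <- s) quad_form F x =
  \sum_k \sum_(x <- s) quad_form F x * (x 0 k * x 0 k).
Proof.
rewrite exchange_big; apply: eq_big_seq => x xs /=.
by rewrite -mulr_sumr unit_norm// mulr1.
Qed.

(** The weighted sum gives |2 F_ij + d_ij tr F| <= (n + 2) tr F; moving the term d_ij tr F across
    costs one more trace, whence n + 3. *)
Lemma le_trace_of_quad_form_ge0 (F : 'M[R]_n) : s != [::] -> F^T = F ->
  (forall x, x \in s -> 0 <= quad_form F x) ->
  forall i j, 2 * `|F i j| <= (n%:R + 3) * \tr F.
Proof.
move=> s0 Fsym Fge0 i j.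
have [b bE] := moment4E.
have tot G : \sum_(x <- s) quad_form G x = b * (n%:R + 2) * \tr G.
  rewrite sum_quad_form.
  under eq_bigr do rewrite (quad_form_moment _ _ _ bE) eqxx mulr1.
  rewrite -mulr_sumr -mulrA; congr (_ * _).
  rewrite !big_split /= sumr_const card_ord -/(\tr G) -mulr_natl; ring.
(* For the identity form the total is the number of vectors in [s], which is positive. *)
have b0 : 0 < b.
  have : 0 < b * ((n%:R + 2) * n%:R).
    rewrite (_ : _ * _ = \sum_(x <- s) quad_form 1%:M x); last first.
      by rewrite tot mxtrace1 mulrA.
    rewrite big_seq.
    under eq_bigr => x xs do rewrite quad_form1 unit_norm//.
    by rewrite -big_seq big_const_seq count_predT iter_addr_0 ltr0n lt0n size_eq0.
  apply: contraTT; rewrite -!leNgt => ?.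
  by rewrite mulr_le0_ge0// mulr_ge0// addr_ge0.
have tr0 : 0 <= \tr F.
  rewrite -(@pmulr_rge0 _ (b * (n%:R + 2))) ?mulr_gt0 ?ltr_wpDl//.
  by rewrite -tot big_seq; apply: sumr_ge0.
have : `|\sum_(x <- s) quad_form F x * (x 0 i * x 0 j)| <= b * (n%:R + 2) * \tr F.
  rewrite -tot big_seq [leRHS]big_seq; apply: le_trans (ler_norm_sum _ _ _) _.
  apply: ler_sum => x xs; rewrite normrM (ger0_norm (Fge0 _ xs)).
  by rewrite ler_piMr ?Fge0// normrM mulr_ile1 ?unit_norm_le1.
have Fji : F j i = F i j by rewrite -{1}Fsym mxE.
rewrite (quad_form_moment _ _ _ bE) Fji normrM (gtr0_norm b0) -!mulrA ler_pM2l//.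
move: (F i j) (n%:R) (\tr F) (i == j) tr0 => y m t d t0 h.
have /ler_normlP[] : `|y + y| <= (m + 3) * t.
  rewrite (_ : y + y = (t * d%:R + y + y) - t * d%:R); last by ring.
  apply: le_trans (ler_normB _ _) _.
  rewrite (_ : (m + 3) * t = (m + 2) * t + t); last by ring.
  by apply: lerD => //; case: d {h}; rewrite ?mulr1 ?mulr0 ?ger0_norm.
by case: (ler0P y); lra.
Qed.

Lemma exp_quad_form_le_det : s != [::] ->
  exists2 e : R, 0 < e & forall S : 'M[R]_n, S^T = S ->
    (forall i j, `|S i j - (1%:M : 'M[R]_n) i j| <= e) ->
    exists2 x, x \in s & 0 <= quad_form S x /\ quad_form S x ^+ n <= \det S.
Proof.
move=> s0; have [C C0 detC] := det1D_ge R n.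
(* [det1D_ge] will be applied with entry bound (m + 3) / 2 * t, where t is the trace of [F]; its
   error term is then K t^2. *)
pose m : R := n%:R; pose K := C * ((m + 3) / 2) ^+ 2.
have m0 : 0 <= m by exact: ler0n.
have K0 : 0 <= K by rewrite mulr_ge0 ?sqr_ge0.
have mK0 : 0 <= m * K by exact: mulr_ge0.
have mm0 : 0 <= m * (m + 3) / 2 by nra.
(* The entries of [F] will be at most 2 (1 + m^2) e = 1 / D, so t <= m / D. The summands of [D] then
   give K t <= 1 and (m + 3) / 2 * t <= 1, while D >= 1 ensures r >= 1 / 2. *)
pose D := 1 + m * K + m * (m + 3) / 2.
have D1 : 1 <= D.
  by rewrite /D; lra.
pose e := (2 * (1 + m ^+ 2) * D)^-1.
have m2 : 0 < 1 + m ^+ 2 by rewrite ltr_pwDl ?sqr_ge0.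
have D0 : 0 < D by apply: lt_le_trans D1.
have e0 : 0 < e by rewrite invr_gt0 !mulr_gt0.
have eE : 2 * ((1 + m ^+ 2) * e) * D = 1.
  by rewrite /e; field; rewrite !gt_eqF.
exists e => // S Ssym Se.
have [x xs xmin] := exists_min_seq (quad_form S) s0; exists x => //.
set r := quad_form S x in xmin *.
have rle : `|r - 1| <= m ^+ 2 * e.
  have -> : r - 1 = quad_form (S - 1%:M) x.
    rewrite /quad_form mulmxBr mulmxBl mxE [X in _ = _ + X]mxE -/(quad_form 1%:M x).
    by rewrite quad_form1 unit_norm.
  rewrite quad_formE; apply: le_trans (ler_norm_sum _ _ _) _.
  apply: (@le_trans _ _ (\sum_(i < n) m * e)); last first.
    by rewrite sumr_const card_ord -mulr_natl expr2 mulrA.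
  apply: ler_sum => i _; apply: le_trans (ler_norm_sum _ _ _) _.
  apply: (@le_trans _ _ (\sum_(j < n) e)); last first.
    by rewrite sumr_const card_ord -mulr_natl.
  apply: ler_sum => j _; rewrite normrM -[leRHS]mulr1 ler_pM//.
    by rewrite !mxE; have := Se i j; rewrite mxE.
  by rewrite normrM mulr_ile1 ?unit_norm_le1.
have mr : m ^+ 2 * e <= 1 / 2 by nra.
have r2 : 1 / 2 <= r by move: rle; rewrite ler_norml => /andP[]; lra.
have r0 : 0 < r by lra.
split; first exact: ltW.
pose F := r^-1 *: S - 1%:M.
have SF : S = r *: (1%:M + F).
  by rewrite addrC subrK scalerA divff ?scale1r// gt_eqF.
have Fsym : F^T = F by rewrite linearB linearZ /= Ssym trmx1.
(* This is the minimality of [r] among the values of the form on [s]. *)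
have Fge0 y : y \in s -> 0 <= quad_form F y.
  move=> ys; rewrite (_ : quad_form F y = r^-1 * quad_form S y - 1).
    by rewrite subr_ge0 -(mulVf (lt0r_neq0 r0)) ler_pM2l ?invr_gt0 ?xmin.
  rewrite /quad_form mulmxBr mulmxBl mxE [X in _ + X = _]mxE -/(quad_form 1%:M y).
  by rewrite quad_form1 unit_norm// -scalemxAr -scalemxAl mxE.
have Fle := le_trace_of_quad_form_ge0 s0 Fsym Fge0.
(* Here [r^-1] contributes the factor 2, [S - 1] contributes [e], and [r - 1] contributes
   [m ^+ 2 * e]. *)
have Fsmall i j : `|F i j| <= 2 * ((1 + m ^+ 2) * e).
  rewrite (_ : F i j = r^-1 * ((S i j - (1%:M : 'M[R]_n) i j) -
      (r - 1) * (1%:M : 'M[R]_n) i j)); last first.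
    by rewrite !mxE; field; rewrite gt_eqF.
  rewrite normrM ler_pM//.
    by rewrite normfV gtr0_norm// -[leRHS]invrK lef_pV2 ?posrE ?invr_gt0//; lra.
  apply: le_trans (ler_normB _ _) _; rewrite [leRHS]mulrDl mul1r; apply: lerD => //.
  rewrite normrM; apply: le_trans rle; rewrite ler_piMr// mxE.
  by case: (i == j); rewrite ?normr1 ?normr0.
set t := \tr F in Fle.
set e1 := 2 * ((1 + m ^+ 2) * e) in eE Fsmall.
have tle : t <= m * e1.
  rewrite /t /mxtrace mulr_natl -[X in _ <= _ *+ X]card_ord -sumr_const.
  by apply: ler_sum => i _; apply: le_trans (ler_norm _) (Fsmall i i).
have e10 : 0 <= e1 by rewrite /e1 !mulr_ge0// ltW.
have e1D : e1 + e1 * (m * K) + e1 * (m * (m + 3) / 2) = 1.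
  by rewrite -[RHS]eE /D; ring.
have t0 : 0 <= t.
  have [i|no] := pickP 'I_n; last by rewrite /t /mxtrace big1// => i; have := no i.
  have m3 : 0 < m + 3 by lra.
  by rewrite -(pmulr_rge0 _ m3) (le_trans _ (Fle i i))// mulr_ge0.
have eta1 : (m + 3) / 2 * t <= 1.
  apply: (@le_trans _ _ ((m + 3) / 2 * (m * e1))).
    by rewrite ler_wpM2l// divr_ge0// addr_ge0.
  have := mulr_ge0 e10 mK0; lra.
have Kt : K * t <= 1.
  apply: (@le_trans _ _ (K * (m * e1))); first by rewrite ler_wpM2l.
  have := mulr_ge0 e10 mm0; lra.
have Feta i j : `|F i j| <= (m + 3) / 2 * t.
  by have := Fle i j; rewrite -/m; lra.
(* The determinant of 1 + F is at least 1 + t - K t^2, and this is at least 1 because t >= 0 and K t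
   <= 1. *)
have := detC F _ eta1 Feta; rewrite -/t exprMn mulrA -/K => dF.
rewrite SF detZ ler_peMr ?exprn_ge0 ?(ltW r0)//.
apply: le_trans dF; rewrite expr2 mulrA.
have := ler_wpM2r t0 Kt; lra.
Qed.
End Moments.

(** * Lattice invariants *)

Section LatticeInvariants.
Variables (R : realType) (n : nat).
Implicit Types (L : set 'rV[R]_n) (B P : 'M[R]_n).

Lemma dotE (x y : 'rV[R]_n) : dot x y = (x *m y^T) 0 0.
Proof. by rewrite mxE; apply: eq_bigr => i _; rewrite mxE. Qed.

Lemma dot_ge0 (x : 'rV[R]_n) : 0 <= dot x x.
Proof. by apply: sumr_ge0 => i _; rewrite -expr2 sqr_ge0. Qed.

Lemma dot_mulmx (x : 'rV[R]_n) P : dot (x *m P) (x *m P) = quad_form (P *m P^T) x.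
Proof. by rewrite dotE trmx_mul /quad_form !mulmxA. Qed.

Lemma dotZ (c : R) (x : 'rV[R]_n) : dot (c *: x) (c *: x) = c ^+ 2 * dot x x.
Proof. by rewrite mulr_sumr; apply: eq_bigr => i _; rewrite !mxE; ring. Qed.

Definition nonzero_norms L := [set dot x x | x in [set x | L x /\ x <> 0]].

Definition is_min L (m : R) := nonzero_norms L m /\ lbound (nonzero_norms L) m.

Lemma lattice_minE L m : is_min L m -> lattice_min L = m.
Proof.
rewrite /lattice_min; case: xgetP => [a _ [La aL] [Lm mL]|no Lm].
  by apply/eqP; rewrite eq_le mL// aL.
by case: (no m).
Qed.

Lemma lattice_min_default L : (forall m, ~ is_min L m) -> lattice_min L = 0.
Proof. by rewrite /lattice_min => no; case: xgetP => // m _ Lm; case: (no m). Qed.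

Lemma lattice_min_ge0 L : 0 <= lattice_min L.
Proof.
rewrite /lattice_min; case: xgetP => // m _ [[x _ <-] _]; exact: dot_ge0.
Qed.

(* Whether [L] has a minimum is irrelevant: otherwise [lattice_min L = 0]. *)
Lemma lattice_min_le L y : L y -> y <> 0 -> lattice_min L <= dot y y.
Proof.
rewrite /lattice_min; case: xgetP => [m _ [_ mL] Ly y0|_ _ _]; last exact: dot_ge0.
by apply: mL; exists y.
Qed.

Lemma dot_orthogonal P x : orthogonal_mx P -> dot (x *m P) (x *m P) = dot x x.
Proof. by move=> PP; rewrite dot_mulmx PP dotE /quad_form mulmx1. Qed.

Lemma is_min_similar L L' c P m : 0 < c -> orthogonal_mx P ->
  L' = [set c *: (x *m P) | x in L] -> is_min L m -> is_min L' (c ^+ 2 * m).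
Proof.
move=> c0 PP -> [[x [Lx x0] xm] mL].
have nz y : c *: (y *m P) <> 0 <-> y <> 0.
  split=> yn0 y0; apply: yn0; first by rewrite y0 mul0mx scaler0.
  move/(congr1 (fun z => c^-1 *: z *m P^T)): y0.
  by rewrite scalerA mulVf ?gt_eqF// scale1r -mulmxA PP mulmx1 scaler0 mul0mx.
split.
  exists (c *: (x *m P)); last by rewrite dotZ dot_orthogonal// xm.
  by split; [exists x | apply/nz].
move=> _ [_ [[y Ly <-] /nz y0] <-]; rewrite dotZ dot_orthogonal//.
by rewrite ler_pM2l ?exprn_gt0//; apply: mL; exists y.
Qed.

(** If [L] has no minimum, the inverse similarity shows that [L'] has none either, and both sides
    take the default value 0. *)
Lemma lattice_min_similar L L' c P : 0 < c -> orthogonal_mx P ->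
  L' = [set c *: (x *m P) | x in L] -> lattice_min L' = c ^+ 2 * lattice_min L.
Proof.
move=> c0 PP L'E; have [[m Lm]|no] := pselect (exists m, is_min L m).
  by rewrite (lattice_minE Lm) (lattice_minE (is_min_similar c0 PP L'E Lm)).
rewrite [X in _ * X]lattice_min_default => [|m Lm]; last by apply: no; exists m.
rewrite mulr0 lattice_min_default// => m L'm; apply: no.
have cV0 : 0 < c^-1 by rewrite invr_gt0.
have PT : orthogonal_mx P^T by rewrite /orthogonal_mx trmxK; exact: mulmx1C.
exists (c^-1 ^+ 2 * m); apply: is_min_similar cV0 PT _ L'm; rewrite L'E.
have back x : c^-1 *: (c *: (x *m P) *m P^T) = x.
  by rewrite -scalemxAl scalerA mulVf ?gt_eqF// scale1r -mulmxA PP mulmx1.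
apply/seteqP; split=> [x Lx|_ [_ [x Lx <-] <-]]; last by rewrite back.
by exists (c *: (x *m P)); [exists x | rewrite back].
Qed.

(** * Bases, determinant and density *)

Lemma lattice_ofE B :
  lattice_of B = [set map_mx intr a *m B | a in [set: 'rV[int]_n]].
Proof.
have sumE (a : 'I_n -> int) :
    \sum_i (a i)%:~R *: row i B = map_mx intr (\row_i a i) *m B.
  by rewrite mulmx_sum_row; apply: eq_bigr => i _; rewrite !mxE.
apply/seteqP; split=> [_ [a ->]|_ [a _ <-]]; first by exists (\row_i a i).
exists (a 0); rewrite sumE; congr (map_mx _ _ *m _).
by apply/rowP => i; rewrite mxE.
Qed.

Lemma lattice_of_subset B1 B2 : lattice_of B1 `<=` lattice_of B2 ->
  exists G : 'M[int]_n, B1 = map_mx intr G *m B2.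
Proof.
move=> sub.
have /choice[g gE] i : exists g : 'rV[int]_n, row i B1 = map_mx intr g *m B2.
  have : lattice_of B1 (row i B1).
    exists (fun j => (j == i)%:R); rewrite (bigD1 i)//= eqxx scale1r.
    by rewrite big1 ?addr0// => j /negbTE ->; rewrite scale0r.
  by move=> /sub; rewrite lattice_ofE => -[g _ <-]; exists g.
exists (\matrix_i g i); apply/row_matrixP => i.
by rewrite row_mul -map_row rowK gE.
Qed.

(** Each inclusion gives an integral change of basis. Composing them fixes [B2], which can be
    cancelled, and integer matrices embed into real ones. *)
Lemma lattice_of_eq B1 B2 : B2 \in unitmx -> lattice_of B1 = lattice_of B2 ->
  exists G H : 'M[int]_n,
    [/\ H *m G = 1%:M, G *m H = 1%:M & B1 = map_mx intr G *m B2].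
Proof.
move=> B2u E.
have [|G GE] := @lattice_of_subset B1 B2; first by rewrite E.
have [|H HE] := @lattice_of_subset B2 B1; first by rewrite E.
have HG : H *m G = 1%:M.
  suff E' : map_mx intr (H *m G) = map_mx (intr : int -> R) 1%:M.
    apply/matrixP => i j; apply: (@intr_inj R).
    by have := congr1 (fun M : 'M[R]_n => M i j) E'; rewrite /= !mxE.
  rewrite map_mxM map_mx1 -[LHS]mulmx1 -(mulmxV B2u) mulmxA.
  by rewrite -(mulmxA (map_mx _ H)) -GE -HE.
by exists G, H; split => //; exact: mulmx1C.
Qed.

Lemma lattice_of_unimodular (G H : 'M[int]_n) B : G *m H = 1%:M ->
  lattice_of (map_mx intr G *m B) = lattice_of B.
Proof.
move=> GH; have HG := mulmx1C GH.
rewrite !lattice_ofE; apply/seteqP; split=> [_ [a _ <-]|_ [a _ <-]].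
  by exists (a *m G) => //; rewrite map_mxM mulmxA.
by exists (a *m H) => //; rewrite mulmxA -map_mxM -mulmxA HG mulmx1.
Qed.

(** The basis picked by [xget] differs from [B] by a unimodular matrix, whose determinant 1 or -1
    disappears in the square. *)
Lemma lattice_detE B : B \in unitmx -> lattice_det (lattice_of B) = \det B ^+ 2.
Proof.
move=> Bu; rewrite /lattice_det; case: xgetP => [B' _ [B'u E]|]; last first.
  by move=> /(_ B) []; split.
have gramE (A : 'M[R]_n) : gram A = A *m A^T.
  apply/matrixP => i j; rewrite !mxE; apply: eq_bigr => k _; by rewrite !mxE.
rewrite gramE det_mulmx det_tr -expr2.
have [G [H [HG _ ->]]] := lattice_of_eq Bu (esym E).
rewrite det_mulmx det_map_mx exprMn.
suff -> : (\det G)%:~R ^+ 2 = 1 :> R by rewrite mul1r.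
have /eqP := congr1 determinant HG; rewrite det_mulmx det1 => /eqP dHG.
have := congr1 absz dHG; rewrite abszM => /eqP; rewrite muln_eq1 => /andP[_ /eqP d1].
case: (\det G) d1 => [m|[|m]] // m1; last by rewrite NegzE rmorphN sqrrN expr1n.
by have -> : m = 1%N; [exact: m1 | rewrite expr1n].
Qed.

Lemma lattice_of_similar c P B :
  [set c *: (x *m P) | x in lattice_of B] = lattice_of (c *: (B *m P)).
Proof.
have E (a : 'rV[R]_n) : c *: (a *m B *m P) = a *m (c *: (B *m P)).
  by rewrite -scalemxAr mulmxA.
rewrite !lattice_ofE; apply/seteqP; split=> [_ [_ [a _ <-] <-]|_ [a _ <-]].
  by exists a.
by exists (map_mx intr a *m B); [exists a | rewrite E].
Qed.

Lemma orthogonal_unitmx P : orthogonal_mx P -> P \in unitmx.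
Proof. by move=> /mulmx1_unit[]. Qed.

(** The scaling multiplies both min^n and det by c^(2n), and the orthogonal factor has determinant
    of square 1. *)
Lemma density_similar B B' : B \in unitmx -> B' \in unitmx ->
  Defs.similar (lattice_of B) (lattice_of B') ->
  density (lattice_of B') = density (lattice_of B).
Proof.
move=> Bu B'u [c [P [c0 PP E]]]; rewrite /density (lattice_min_similar c0 PP E).
have cBP : c *: (B *m P) \in unitmx.
  by rewrite unitmxZ ?unitfE ?gt_eqF// unitmx_mul Bu orthogonal_unitmx.
rewrite E lattice_of_similar !lattice_detE// detZ det_mulmx.
have dP : \det P ^+ 2 = 1.
  by have := congr1 determinant PP; rewrite det_mulmx det_tr det1.
have dB : \det B != 0 by rewrite -unitfE -unitmxE.
congr (_ * Num.sqrt _).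
rewrite !exprMn dP mulr1.
by field; rewrite dB gt_eqF// exprn_gt0.
Qed.

Lemma unit_ball_volume_ge0 : 0 <= unit_ball_volume R n.
Proof.
apply: fine_ge0; elim: n (unit_ball R n) => [|m IH] A /=.
  by rewrite lee_fin indicE.
by apply: integral_ge0 => t _; exact: IH.
Qed.

Lemma density_le B B' : B \in unitmx -> B' \in unitmx ->
  lattice_min (lattice_of B') ^+ n * \det B ^+ 2 <=
  lattice_min (lattice_of B) ^+ n * \det B' ^+ 2 ->
  density (lattice_of B') <= density (lattice_of B).
Proof.
move=> Bu B'u le; rewrite /density !lattice_detE//.
have d0 (A : 'M[R]_n) : A \in unitmx -> 0 < \det A ^+ 2.
  by move=> Au; rewrite exprn_even_gt0 // -unitfE -unitmxE Au orbT.
rewrite ler_wpM2l ?divr_ge0 ?exprn_ge0 ?unit_ball_volume_ge0//.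
apply: ler_wsqrtr.
by rewrite ler_pdivrMr ?d0// mulrAC ler_pdivlMr ?d0.
Qed.

End LatticeInvariants.

(** * Spherical designs *)

(** A matrix neighbourhood contains a product of finitely many entrywise neighbourhoods. *)
Lemma continuous_to_mx (T R : topologicalType) (m n : nat)
    (f : T -> 'M[R]_(m, n)) :
  (forall i j, continuous (fun t => f t i j)) -> continuous f.
Proof.
move=> fc t A [P Pf PA].
have : \forall u \near t, forall ij : 'I_m * 'I_n, P ij.1 ij.2 (f u ij.1 ij.2).
  by apply: filter_forall => -[i j]; exact/fc/Pf.
apply: filterS => u Pu; apply: PA => i j; exact: (Pu (i, j)).
Qed.

Lemma continuous_sum (K : numFieldType) (T : topologicalType) (I : Type)
    (r : seq I) (F : I -> T -> K) :
  (forall i, continuous (F i)) -> continuous (fun x => \sum_(i <- r) F i x).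
Proof.
move=> Fc x; apply: cvg_big => [|i _]; first exact: add_continuous.
exact: Fc.
Qed.

Lemma continuous_mul (K : numFieldType) (T : topologicalType) (f g : T -> K) :
  continuous f -> continuous g -> continuous (fun x => f x * g x).
Proof. by move=> fc gc x; apply: cvgM; [exact: fc | exact: gc]. Qed.

Lemma continuous_mulmx (K : numFieldType) (T : topologicalType) (m n p : nat)
    (f : T -> 'M[K]_(m, n)) (g : T -> 'M[K]_(n, p)) :
  continuous f -> continuous g -> continuous (fun t => f t *m g t).
Proof.
move=> fc gc; apply: continuous_to_mx => i j.
rewrite (_ : (fun _ => _) = fun t => \sum_k f t i k * g t k j); last first.
  by apply/funext => t; rewrite mxE.
apply: continuous_sum => k; apply: continuous_mul => t.
  exact: (continuous_comp (fc t) (@coord_continuous _ _ _ i k _)).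
exact: (continuous_comp (gc t) (@coord_continuous _ _ _ k j _)).
Qed.

Lemma continuous_trmx (K : numFieldType) (m n : nat) :
  continuous (trmx : 'M[K]_(m, n) -> 'M[K]_(n, m)).
Proof.
apply: continuous_to_mx => i j.
rewrite (_ : (fun _ => _) = fun M : 'M[K]_(m, n) => M j i).
  exact: coord_continuous.
by apply/funext => M; rewrite mxE.
Qed.

(** * Orthogonal invariance of integrals over the sphere *)

Section SphereIntegral.
Variables (R : realType) (n : nat).
Local Notation borel := (@borel_space R n).

Lemma borel_measurable_fun (f : 'rV[R]_n -> R) :
  continuous f -> measurable_fun [set: borel] (f : borel -> R).
Proof.
move=> fc; apply: (measurability _ (RGenOpens.measurableE R)).
move=> _ [_ [a [b ->] <-]]; rewrite setTI; apply: sub_sigma_algebra.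
by move/continuousP : fc; apply; exact: interval_open.
Qed.

Lemma borel_measurable_mulmx (P : 'M[R]_n) :
  measurable_fun [set: borel] ((fun x : 'rV[R]_n => x *m P) : borel -> borel).
Proof.
apply: (@measurability _ _ borel borel setT _ (@open 'rV[R]_n)) => //.
move=> _ [A oA <-]; rewrite setTI; apply: sub_sigma_algebra.
have : continuous (fun x : 'rV[R]_n => x *m P).
  by apply: continuous_mulmx => x; [exact: cvg_id | exact: cst_continuous].
by move/continuousP; apply.
Qed.

Lemma continuous_dot : continuous (fun x : 'rV[R]_n => dot x x).
Proof.
apply: continuous_sum => i; apply: continuous_mul; exact: coord_continuous.
Qed.

Lemma unit_sphere_measurable : measurable (unit_sphere R n : set borel).
Proof.
rewrite (_ : unit_sphere R n = ((fun x => dot x x) : borel -> R) @^-1` [set 1])//.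
rewrite -[X in measurable X]setTI; apply: borel_measurable_fun => //.
exact: continuous_dot.
Qed.

Variables (mu : probability borel R) (sphere_mu : sphere_measure mu).
Variables (P : 'M[R]_n) (orthP : orthogonal_mx P).

(** Change of variables: [mu] is its own pushforward under x |-> x P, and the preimage of the sphere
    is the sphere. *)
Lemma ge0_sphere_integral_orthogonal (g : borel -> \bar R) :
  measurable_fun [set: borel] g -> (forall x, (0 <= g x)%E) ->
  (\int[mu]_(x in unit_sphere R n) g ((x : 'rV[R]_n) *m P) =
   \int[mu]_(x in unit_sphere R n) g x)%E.
Proof.
move=> mg g0; have [_ /(_ _ orthP) muP] := sphere_mu.
pose phi : borel -> borel := fun x => (x : 'rV[R]_n) *m P.
have mphi : measurable_fun [set: borel] phi := borel_measurable_mulmx P.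
rewrite [RHS](eq_measure_integral (pushforward mu phi)).
  rewrite ge0_integral_pushforward//.
  - rewrite (_ : _ @^-1` unit_sphere R n = unit_sphere R n)//.
    by apply/seteqP; split=> x /=; rewrite /unit_sphere /= dot_orthogonal.
  - exact: unit_sphere_measurable.
  - exact: measurable_funTS.
by move=> A mA _; symmetry; exact: muP.
Qed.

(** The extended integrals already agree, by applying the nonnegative case to the positive and
    negative parts. *)
Lemma sphere_Rintegral_orthogonal (f : 'rV[R]_n -> R) : continuous f ->
  \int[mu]_(x in unit_sphere R n) f ((x : 'rV[R]_n) *m P) =
  \int[mu]_(x in unit_sphere R n) f x.
Proof.
move=> /borel_measurable_fun/measurable_EFinP fm; congr fine.
rewrite [LHS]integralE [RHS]integralE; congr (_ - _)%E.
  rewrite -(ge0_sphere_integral_orthogonal (g := (EFin \o f)^\+%E))//.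
    by apply: eq_integral => x _; rewrite !funeposE.
  exact: measurable_funepos.
rewrite -(ge0_sphere_integral_orthogonal (g := (EFin \o f)^\-%E))//.
  by apply: eq_integral => x _; rewrite !funenegE.
exact: measurable_funeneg.
Qed.

End SphereIntegral.

Section Design.
Import -(notations) mpoly.
Variables (R : realType) (n : nat).

Definition linear_form (P : 'M[R]_n) (i : 'I_n) : mpoly n R :=
  \sum_j P j i *: mpolyX R (mnm1 j).

Lemma meval_linear_form P i (x : 'rV[R]_n) :
  meval (fun j => x 0 j) (linear_form P i) = (x *m P) 0 i.
Proof.
rewrite raddf_sum mxE; apply: eq_bigr => j _.
by rewrite /= mevalZ mevalXU mulrC.
Qed.

Lemma linear_form_homog P i : linear_form P i \is ishomog1 1 mdeg.
Proof.
apply: rpred_sum => j _; apply: rpredZ; by rewrite dhomogX /= mdeg1.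
Qed.

(** Both monomials, in the coordinates of x P and of x, are homogeneous quartics. Their averages
    over [X] are sphere integrals, equal by invariance, and the factor 1 / |X| cancels since [X] is
    nonempty. *)
Lemma spherical_design_moment4 (t : nat) (X : set 'rV[R]_n) (P : 'M[R]_n) :
  (4 <= t)%N -> spherical_design t X -> orthogonal_mx P ->
  let s := enum_fset (fset_set X) in
  forall i j k l,
    \sum_(x <- s) (x *m P) 0 i * (x *m P) 0 j * (x *m P) 0 k * (x *m P) 0 l =
    moment4 s i j k l.
Proof.
move=> t4 [Xfin [x0 Xx0] _ [mu smu design]] PP s i j k l.
pose f Q : mpoly n R := linear_form Q i * linear_form Q j * linear_form Q k
  * linear_form Q l.
have fE Q (x : 'rV[R]_n) : meval (fun i => x 0 i) (f Q) =
    (x *m Q) 0 i * (x *m Q) 0 j * (x *m Q) 0 k * (x *m Q) 0 l.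
  by rewrite !mevalM !meval_linear_form.
have f4 Q : f Q \is ishomog1 4 mdeg.
  rewrite (_ : 4%N = (1 + 1 + 1 + 1)%N)//.
  by do !apply: dhomogM; exact: linear_form_homog.
have := design _ _ t4 (f4 1%:M); have := design _ _ t4 (f4 P).
have N0 : (#|` fset_set X|%:R)^-1 != 0 :> R.
  rewrite invr_eq0 pnatr_eq0 cardfs_eq0; apply/eqP => X0.
  have : x0 \in fset_set X by rewrite in_fset_set// inE.
  by rewrite X0 in_fset0.
have -> : \int[mu]_(x in unit_sphere R n)
      meval (fun i => (x : 'rV[R]_n) 0 i) (f P) =
    \int[mu]_(x in unit_sphere R n)
      meval (fun i => (x : 'rV[R]_n) 0 i) (f 1%:M).
  pose g (x : 'rV[R]_n) : R := x 0 i * x 0 j * x 0 k * x 0 l.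
  rewrite (_ : (fun x : borel_space => _) =
      (fun x : borel_space => g ((x : 'rV[R]_n) *m P))).
    rewrite (sphere_Rintegral_orthogonal smu PP); last first.
      by do !apply: continuous_mul; exact: coord_continuous.
    by congr (Rintegral _ _ _); apply/funext => x; rewrite fE mulmx1.
  by apply/funext => x; rewrite fE.
move=> <- /(mulfI N0); rewrite !fsbig_finite//= => E.
transitivity (\sum_(x <- s) meval (fun i => x 0 i) (f P)).
  by apply: eq_bigr => x _; rewrite fE.
by rewrite -E; apply: eq_bigr => x _; rewrite fE mulmx1.
Qed.

End Design.

(** * Local maximality *)

Section LocalMaximum.
Variables (R : realType) (n : nat).

(** [T] acts on the right, so a vector x of [L] moves to x T, whose norm is the value at x of the
    form T T^T. *)
Lemma strongly_perfect_density_le (B0 : 'M[R]_n) :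
  B0 \in unitmx -> strongly_perfect (lattice_of B0) ->
  exists2 e : R, 0 < e & forall T : 'M[R]_n, T \in unitmx ->
    (forall i j, `|(T *m T^T) i j - (1%:M : 'M[R]_n) i j| <= e) ->
    density (lattice_of (B0 *m T)) <= density (lattice_of B0).
Proof.
set L := lattice_of B0; set m := lattice_min L => B0u perf.
have moments P (PP : orthogonal_mx P) := spherical_design_moment4 (leqnn 4) perf PP.
have [Xfin [x0 Xx0] Xsphere _] := perf.
set X := [set _ | _ in _] in moments Xfin Xx0 Xsphere.
(* If the minimum were 0, its inverse square root would be 0 by convention, and the rescaled vectors
   would be 0 rather than on the sphere. *)
have m0 : 0 < m.
  rewrite lt_neqAle lattice_min_ge0 andbT; apply/negP => /eqP m0.
  have [y _ x0E] := Xx0; have := Xsphere _ Xx0.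
  rewrite /unit_sphere/= -x0E -/m -m0 sqrtr0 invr0 dotZ expr0n mul0r.
  by move/esym/eqP; rewrite oner_eq0.
set s := enum_fset (fset_set X) in moments.
have sX x : x \in s -> X x by rewrite in_fset_set// inE.
have s0 : s != [::].
  by apply/eqP => s0; have : x0 \in s; [rewrite in_fset_set// inE | rewrite s0].
have unit_s x : x \in s -> \sum_i x 0 i * x 0 i = 1 by move=> /sX/Xsphere.
have [e e0 detS] := exp_quad_form_le_det moments unit_s s0.
exists e => // T Tu Te; set S := T *m T^T.
have [x xs [q0 qS]] : exists2 x, x \in s &
    0 <= quad_form S x /\ quad_form S x ^+ n <= \det S.
  by apply: detS => //; rewrite trmx_mul trmxK.
have BTu : B0 *m T \in unitmx by rewrite unitmx_mul B0u.
apply: density_le => //.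
have [y [Ly ym] xE] := sX _ xs.
have yT : lattice_of (B0 *m T) (y *m T).
  move: Ly; rewrite /L !lattice_ofE => -[a _ <-].
  by exists a => //; rewrite mulmxA.
have yT0 : y *m T <> 0.
  move/(congr1 (fun z => z *m invmx T)); rewrite mul0mx mulmxK// => y0.
  by move: ym; rewrite y0 dotE mul0mx mxE -/m; apply/eqP; rewrite lt_eqF.
have sm0 : Num.sqrt m != 0 by rewrite gt_eqF// sqrtr_gt0.
(* The moved minimal vector y T is a nonzero vector of the new lattice, so its norm bounds the new
   minimum from above. *)
have muq : lattice_min (lattice_of (B0 *m T)) <= m * quad_form S x.
  have -> : m * quad_form S x = dot (y *m T) (y *m T).
    have -> : y = Num.sqrt m *: x by rewrite -xE scalerA divff// scale1r.
    by rewrite -scalemxAl dotZ sqr_sqrtr ?ltW// dot_mulmx.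
  exact: lattice_min_le.
rewrite det_mulmx exprMn [leLHS]mulrC [leRHS]mulrCA ler_wpM2l ?sqr_ge0//.
have -> : \det T ^+ 2 = \det S by rewrite det_mulmx det_tr.
apply: (@le_trans _ _ ((m * quad_form S x) ^+ n)).
  by rewrite lerXn2r// ?nnegrE ?lattice_min_ge0// mulr_ge0// ltW.
by rewrite exprMn ler_wpM2l// exprn_ge0// ltW.
Qed.

(** * Topology of the space of similarity classes *)

Definition bases_of_unitmx (B : 'M[R]_n) (Bu : B \in unitmx) : bases R n :=
  exist (fun M => M \in bases R n) B (mem_set Bu).

(* Similar bases differ by a homeomorphism [B |-> G B P] of GL_n that stays
   within similarity classes, so the saturation of an open set is open. *)
Lemma similar_bases_action (B B' : bases R n) : similar_bases B B' ->
  exists G P : 'M[R]_n, set_val B' = G *m set_val B *m P /\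
    forall B1 : bases R n,
      exists2 B2 : bases R n, set_val B2 = G *m set_val B1 *m P &
        similar_bases B1 B2.
Proof.
move=> /asboolP[c [P [c0 PP E]]].
have cBP (B1 : bases R n) : c *: (set_val B1 *m P) \in unitmx.
  rewrite unitmxZ ?unitfE ?gt_eqF// unitmx_mul (orthogonal_unitmx PP) andbT.
  exact: (set_valP B1).
rewrite lattice_of_similar in E.
(* [B'] and c B P generate the same lattice, so a unimodular [G] relates them. The same [G], [c] and
   [P] then act on every basis. *)
have [G [H [HG GH GE]]] := lattice_of_eq (cBP B) E.
have assoc (B1 : 'M[R]_n) :
    c *: map_mx intr G *m B1 *m P = map_mx intr G *m (c *: (B1 *m P)).
  by rewrite -!scalemxAl -scalemxAr mulmxA.
exists (c *: map_mx intr G), P; split; first by rewrite assoc.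
move=> B1; have B2u : map_mx intr G *m (c *: (set_val B1 *m P)) \in unitmx.
  rewrite unitmx_mul cBP andbT.
  have /mulmx1_unit[//] : map_mx intr G *m map_mx intr H = 1%:M :> 'M[R]_n.
  by rewrite -map_mxM GH map_mx1.
exists (bases_of_unitmx B2u); first by rewrite assoc.
apply/asboolP; exists c, P; split => //.
by rewrite lattice_of_similar /= (lattice_of_unimodular _ GH).
Qed.

(** Openness in the quotient is openness of the preimage, here the saturation of [V]. Near a point B
    similar to some B' in [V], the action taking B to B' lands in [V] by continuity. *)
Lemma open_class_image (V : set 'M[R]_n) : open V ->
  open [set class_of B | B in [set B : bases R n | V (set_val B)]].
Proof.
move=> oV; rewrite /open/= /quotient_open openE => B /= [B' VB' BB'].
have /similar_bases_action[G [P [B'E act]]] : similar_bases B B'.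
  by move/eqmodP : BB'; rewrite /= similar_bases_sym.
pose h (B1 : bases R n) := G *m set_val B1 *m P.
have hc : continuous h.
  apply: continuous_mulmx; last by move=> x; exact: cst_continuous.
  apply: continuous_mulmx; first by move=> x; exact: cst_continuous.
  exact: initial_continuous.
have : nbhs B (h @^-1` V).
  by apply: hc; apply: open_nbhs_nbhs; split => //; rewrite /h -B'E.
apply: filterS => B1 /=; have [B2 B2E B12] := act B1; rewrite /h -B2E => VB2.
by exists B2 => //; apply/eqmodP; rewrite /= similar_bases_sym.
Qed.

Lemma class_density_class_of (B : bases R n) :
  class_density (class_of B) = density (lattice_of (set_val B)).
Proof.
pose B' : bases R n := generic_quotient.repr (class_of B).
have /eqmodP : class_of B = class_of B' by rewrite /class_of reprK.
move/asboolP; apply: density_similar; first exact: (set_valP B).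
exact: (set_valP B').
Qed.

(** This is the neighbourhood of [B0] on which T = B0^-1 B satisfies the closeness condition of
    [strongly_perfect_density_le]. *)
Lemma open_gram_ball (B0 : 'M[R]_n) (e : R) : 0 < e ->
  open [set B : 'M[R]_n |
    ball (1%:M : 'M[R]_n) e (invmx B0 *m B *m (invmx B0 *m B)^T)].
Proof.
move=> e0; have hc : continuous (fun B : 'M[R]_n => invmx B0 *m B).
  by apply: continuous_mulmx => x; [exact: cst_continuous | exact: cvg_id].
have : continuous (fun B : 'M[R]_n => invmx B0 *m B *m (invmx B0 *m B)^T).
  apply: continuous_mulmx => // x.
  exact: (continuous_comp (hc x) (@continuous_trmx _ _ _ _)).
by move/continuousP; apply; exact: ball_open.
Qed.

End LocalMaximum.

Theorem mainTheorem1 (R : realType) (n : nat) (L : set 'rV[R]_n)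
    (hL : is_lattice L) (hperf : strongly_perfect L) :
  extreme L.
Proof.
have [B0 B0u LE] := hL; rewrite LE in hperf *.
have [e e0 le_density] := strongly_perfect_density_le B0u hperf.
pose b0 := bases_of_unitmx B0u.
exists b0 => //; rewrite /local_maximum.
have V_open := open_class_image (open_gram_ball (B0 := B0) e0).
have : nbhs (class_of b0) [set class_of B | B in [set B : bases R n |
    ball (1%:M : 'M[R]_n) e (invmx B0 *m set_val B *m (invmx B0 *m set_val B)^T)]].
  apply: open_nbhs_nbhs; split; first exact: V_open.
  by exists b0 => //=; rewrite mulVmx// trmx1 mulmx1; exact: ballxx.
apply: filterS => _ [B [_ B_near] <-]; rewrite !class_density_class_of /=.
(* Every nearby basis is a right perturbation B0 T with T = B0^-1 B. *)
have BE : set_val B = B0 *m (invmx B0 *m set_val B).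
  by rewrite mulmxA mulmxV// mul1mx.
rewrite BE; apply: le_density => [|i j].
  by rewrite unitmx_mul unitmx_inv B0u; exact: (set_valP B).
by rewrite distrC; apply/ltW/B_near.
Qed.
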